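(* Let $X$ be a compactum with no isolated points and let $F\colon X\to 2^X$ be an upper semicontinuous function. Consider the following statements: (1) there exists $p\in X$ such that $p$ has a dense orbit; (2) $F$ is transitive; (3) there exists $p\in X$ such that $p$ has a weak dense orbit. Then (1) implies (2), and (1) implies (3). Moreover, if $F$ is continuous, then (2) implies (3).
   Context: A compactum is a compact metric space. $2^X$ denotes the family of all nonempty closed subsets of $X$; $\mathbb N=\{1,2,3,\ldots\}$. A function $F\colon X\to 2^X$ is upper semicontinuous if for each $x\in X$ and every open $V\subseteq X$ with $F(x)\subseteq V$, there is an open $U\subseteq X$ with $x\in U$ and $F(y)\subseteq V$ for all $y\in U$. It is lower semicontinuous if for each $x\in X$ and every open $V\subseteq X$ with $F(x)\cap V\neq\emptyset$, there is an open $U\subseteq X$ with $x\in U$ and $F(y)\cap V\neq\emptyset$ for each $y\in U$. It is continuous if it is both upper and lower semicontinuous. For $A\subseteq X$, $F(A)=\bigcup\{F(x):x\in A\}$; $F^1=F$ and $F^{n+1}(x)=F(F^n(x))$ for $x \in X$, $n\in\mathbb N$. The orbit set of $p\in X$ is $\mathcal{O}_F(p)=\{(x_n)_{n\in\mathbb N}\in X^{\mathbb N} : x_1=p \text{ and } x_{n+1}\in F(x_n) \text{ for each } n\in\mathbb N\}$. $F$ is transitive if for each pair of nonempty open subsets $U$ and $V$ of $X$ there exist $x\in U$ and $k\in\mathbb N$ such that $F^k(x)\cap V\neq\emptyset$. A point $p\in X$ has a dense orbit if there exists $(x_n)_{n=1}^{\infty}\in\mathcal{O}_F(p)$ such that for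 every nonempty open subset $U$ of $X$ there exists $k\in\mathbb N$ with $x_k\in U$. A point $p\in X$ has a weak dense orbit if for each nonempty open subset $U$ of $X$ there exists $k\in\mathbb N$ such that $F^k(p)\cap U\neq\emptyset$. *)

(* Defs.v *)
From mathcomp Require Import all_boot all_order all_algebra.
From mathcomp Require Import all_classical all_reals all_analysis.

Set Implicit Arguments.
Unset Strict Implicit.
Unset Printing Implicit Defensive.

Local Open Scope classical_set_scope.

(* The family 2^X; a function X -> 2^X is rendered as F : X -> set X together
   with the hypothesis that all its values lie in [hyperspace X]. *)
Definition hyperspace (X : topologicalType) : set (set X) :=
  [set A | closed A /\ A !=set0].
Arguments hyperspace X : clear implicits.

Definition upper_semicontinuous_sv (X : topologicalType) (F : X -> set X) :=
  forall (x : X) (V : set X), open V -> F x `<=` V ->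
    exists U : set X, [/\ open U, U x & forall y, U y -> F y `<=` V].

(* The suffix avoids the library's [lower_semicontinuous], which concerns
   extended-real-valued functions. *)
Definition lower_semicontinuous_sv (X : topologicalType) (F : X -> set X) :=
  forall (x : X) (V : set X), open V -> F x `&` V !=set0 ->
    exists U : set X, [/\ open U, U x & forall y, U y -> F y `&` V !=set0].

Definition continuous_sv (X : topologicalType) (F : X -> set X) :=
  upper_semicontinuous_sv F /\ lower_semicontinuous_sv F.

Definition image_sv (X : Type) (F : X -> set X) (A : set X) : set X :=
  \bigcup_(x in A) F x.

(* F^k(x). The value F^0(x) = {x} is only a device to start the recursion at
   F^1 = F (see [iter_sv1]): the exponents are meant to range over k >= 1, hence
   the guards 0 < k below. *)
Definition iter_sv (X : Type) (F : X -> set X) (k : nat) (x : X) : set X :=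
  iter k (image_sv F) [set x].

Lemma iter_sv1 (X : Type) (F : X -> set X) : iter_sv F 1 = F.
Proof. by apply/funext => x; rewrite /iter_sv /= /image_sv bigcup_set1. Qed.

Lemma iter_svS (X : Type) (F : X -> set X) (k : nat) (x : X) :
  iter_sv F k.+1 x = image_sv F (iter_sv F k x).
Proof. by []. Qed.

(* Sequences are indexed from 0 instead of 1: [x n] is the term x_{n+1}. *)
Definition orbit_set (X : Type) (F : X -> set X) (p : X) : set (nat -> X) :=
  [set x | x 0%N = p /\ forall n : nat, F (x n) (x n.+1)].

Definition transitive_sv (X : topologicalType) (F : X -> set X) :=
  forall U V : set X, open U -> U !=set0 -> open V -> V !=set0 ->
    exists x : X, U x /\
      exists k : nat, (0 < k)%N /\ iter_sv F k x `&` V !=set0.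

Definition has_dense_orbit (X : topologicalType) (F : X -> set X) (p : X) :=
  exists x : nat -> X, orbit_set F p x /\
    forall U : set X, open U -> U !=set0 -> exists k : nat, U (x k).

Definition has_weak_dense_orbit (X : topologicalType) (F : X -> set X)
    (p : X) :=
  forall U : set X, open U -> U !=set0 ->
    exists k : nat, (0 < k)%N /\ iter_sv F k p `&` U !=set0.

(* Main.v *)
(** Without isolated points, deleting finitely many points from a nonempty open
    set leaves a nonempty open set. Hence every tail of a dense orbit is dense:
    an orbit point [x_i] in [U] is followed by some [x_j], [j > i], in [V], and
    [x_j] lies in [F^(j-i)(x_i)]. When [F] is lower semicontinuous
    and transitive, for each basic open [B] the set of points some positive
    iterate of which meets [B] is open and dense; a point in the intersection of
    these countably many sets, given by Baire's theorem, has a weak dense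
    orbit. *)

From HB Require Import structures.
Require Import Defs.
From mathcomp Require Import all_boot all_order all_algebra.
From mathcomp Require Import all_classical all_reals all_analysis.

Local Open Scope classical_set_scope.

(** If [U] were contained in [A], then removing from [U] the finite, hence closed, set [A] minus [x]
    would leave the open set consisting of [x] alone, and [x] would be isolated. *)
Lemma setD_finite_neq0 (T : topologicalType) (U A : set T) :
  accessible_space T -> isolated [set: T] = set0 ->
  open U -> U !=set0 -> finite_set A -> U `\` A !=set0.
Proof.
move=> T1 noiso oU [x Ux] finA.
have fc := accessible_finite_set_closed.1 T1.
apply: contrapT => UA0.
have UA : U `<=` A.
  by move=> y Uy; apply: contrapT => Ay; apply: UA0; exists y.
have oV : open (U `\` (A `\ x)).
  apply: openI => //; rewrite openC; apply: fc.
  exact: finite_setD.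
suff : isolated [set: T] x by rewrite noiso.
split; first by rewrite inE.
exists (U `\` (A `\ x)).
  by apply: open_nbhs_nbhs; split => //; split => // -[_]; exact.
rewrite setIT; apply/seteqP; split => [y [Uy Axy]|y ->].
  by apply: contrapT => yx; apply: Axy; split => //; exact: UA.
by split => // -[_]; exact.
Qed.

Lemma orbit_set_iter (X : Type) (F : X -> set X) (p : X) (x : nat -> X)
    (i k : nat) :
  orbit_set F p x -> iter_sv F k (x i) (x (i + k)%N).
Proof.
move=> [_ xF]; elim: k => [|k IHk]; first by rewrite addn0.
by rewrite addnS iter_svS; exists (x (i + k)%N).
Qed.

Lemma dense_orbit_tail (T : topologicalType) (x : nat -> T) (U : set T)
    (i : nat) :
  accessible_space T -> isolated [set: T] = set0 ->
  (forall V : set T, open V -> V !=set0 -> exists k, V (x k)) ->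
  open U -> U !=set0 -> exists k, (0 < k)%N /\ U (x (i + k)%N).
Proof.
move=> T1 noiso xd oU U0.
(* The removed terms have indices 0 to [i], so a visit to [U] away from them occurs at an index
   greater than [i]. *)
have finA : finite_set (x @` `I_i.+1).
  by apply: finite_image; exact: finite_II.
have oV : open (U `\` x @` `I_i.+1).
  apply: openI => //; rewrite openC.
  exact: accessible_finite_set_closed.1.
have [j [Uj xj]] := xd _ oV (setD_finite_neq0 _ _ _ T1 noiso oU U0 finA).
have ij : (i < j)%N.
  by rewrite ltnNge; apply/negP => ji; apply: xj; exists j.
by exists (j - i)%N; rewrite subn_gt0 ij subnKC // ltnW.
Qed.

Lemma lower_semicontinuous_svP (T : topologicalType) (F : T -> set T) :
  lower_semicontinuous_sv F <->
  forall V : set T, open V -> open [set x | F x `&` V !=set0].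
Proof.
split=> [lscF V oV|oF x V oV FxV]; last first.
  by exists [set z | F z `&` V !=set0]; split => //; exact: oF.
rewrite openE => x FxV; have [U [oU Ux UF]] := lscF x V oV FxV.
by rewrite /interior nbhsE; exists U.
Qed.

(** [F^(k+1)(x)] meets [V] exactly when [F^k(x)] meets the open set of points whose value under [F]
    meets [V]. The induction therefore lets [V] vary. *)
Lemma iter_sv_lsc (T : topologicalType) (F : T -> set T) (k : nat) :
  lower_semicontinuous_sv F -> lower_semicontinuous_sv (iter_sv F k).
Proof.
move=> /lower_semicontinuous_svP oF; apply/lower_semicontinuous_svP.
elim: k => [|k IHk] V oV.
  rewrite (_ : mkset _ = V) //; apply/seteqP; split => [x [_ [->]]//|x Vx].
  by exists x.
rewrite (_ : mkset _ =
    [set x | iter_sv F k x `&` [set y | F y `&` V !=set0] !=set0]).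
  by apply: IHk; exact: oF.
apply/seteqP; split => x.
  by move=> [z [[y Fy yz] Vz]]; exists y; split => //; exists z.
by move=> [y [Fy [z [yz Vz]]]]; exists z; split => //; exists y.
Qed.

(** Regularity of compact Hausdorff spaces yields nonempty open sets [u n], starting from [O], with
    the closure of [u n.+1] inside both [u n] and [W n]. By compactness the filter they generate has
    a cluster point, which lies in all these closures. *)
Lemma Baire_compact (T : topologicalType) (W : nat -> set T) :
  hausdorff_space T -> compact [set: T] ->
  (forall n, open (W n) /\ dense (W n)) -> dense (\bigcap_n W n).
Proof.
move=> hT cT odW O O0 oO.
pose S := {U : set T | open U /\ U !=set0}.
have shrink (nU : nat * S) : exists U' : S,
    closure (sval U') `<=` sval nU.2 `&` W nU.1.
  case: nU => n [U [oU U0]] /=; have [oW dW] := odW n.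
  have [x UWx] := dW _ U0 oU.
  have nx : nbhs x (U `&` W n).
    by apply: open_nbhs_nbhs; split => //; exact: openI.
  have [A Ax AUW] := @compact_regular T x setT hT cT filterT _ nx.
  have oA : open A° by exact: open_interior.
  have A0 : A° !=set0 by exists x.
  exists (exist _ A° (conj oA A0)) => /=.
  by apply: subset_trans AUW; apply: closureS; exact: interior_subset.
have [f fP] := choice shrink.
pose u := fix u n : S :=
  if n is m.+1 then f (m, u m) else exist _ O (conj oO O0).
have uS n : closure (sval (u n.+1)) `<=` sval (u n) `&` W n by exact: fP (n, u n).
have u_le m n : (m <= n)%N -> sval (u n) `<=` sval (u m).
  elim: n => [|n IHn]; first by rewrite leqn0 => /eqP ->.
  rewrite leq_eqVlt => /predU1P[-> //|/IHn um].
  by apply: subset_trans um => y /subset_closure /uS[].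
pose G := filter_from [set: nat] (fun n => sval (u n)).
have GF : ProperFilter G.
  apply: filter_from_proper => [|n _]; last by case: (svalP (u n)).
  apply: filter_from_filter; first by exists 0%N.
  move=> i j _ _; exists (maxn i j) => // x ux.
  by split; apply: u_le ux; rewrite ?leq_maxl ?leq_maxr.
have [p [_ Gp]] := cT G GF filterT.
have pu n : closure (sval (u n)) p.
  by move: Gp; rewrite clusterE; apply; exists n.
(* [u 0] is [O] itself, so membership in [O] is read off the closure of [u 1]. *)
exists p; split; first by have [] := uS 0%N _ (pu 1%N).
by move=> n _; have [] := uS n _ (pu n.+1).
Qed.

(* [compact_second_countable] is stated for pointed spaces only. *)
Lemma compact_metric_second_countable (R : realType) (X : metricType R) :
  [set: X] !=set0 -> compact [set: X] -> @second_countable X.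
Proof.
move=> [x0 _] cX.
pose x0_pointed := isPointed.Build X x0.
pose Y : pseudoPMetricType R := HB.pack (Metric.sort X) x0_pointed.
exact: (@compact_second_countable R Y cX).
Qed.

Lemma transitive_weak_dense_orbit (T : topologicalType) (F : T -> set T) :
  [set: T] !=set0 -> compact [set: T] -> hausdorff_space T ->
  @second_countable T -> lower_semicontinuous_sv F -> transitive_sv F ->
  exists p, has_weak_dense_orbit F p.
Proof.
move=> T0 cT hT [B cB [oB bB]] lscF trF.
pose hit V := [set x | exists k, (0 < k)%N /\ iter_sv F k x `&` V !=set0].
have hit_open V : open V -> open (hit V).
  move=> oV; rewrite (_ : hit V = \bigcup_(k in [set k | (0 < k)%N])
      [set x | iter_sv F k x `&` V !=set0]).
    apply: bigcup_open => k _.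
    exact: (lower_semicontinuous_svP _ _).1 (iter_sv_lsc _ _ k lscF) V oV.
  apply/seteqP; split => x; first by move=> [k [k0 kV]]; exists k.
  by move=> [k k0 kV]; exists k.
have hit_dense V : open V -> V !=set0 -> dense (hit V).
  move=> oV V0 U U0 oU; have [x [Ux xV]] := trF _ _ oU U0 oV V0.
  by exists x.
have [e eP] : exists e : nat -> set T,
    forall V, B V -> V !=set0 -> exists n, e n = V.
  (* An empty base has no surjection from the naturals; any constant sequence then serves
     vacuously. *)
  have [B0|[g]] := pfcard_geP cB.
    by exists (fun=> set0) => V; rewrite B0.
  by exists g => V BV _; have [n _ gn] := @surj _ _ _ _ g V BV; exists n.
(* The guards make [W n] the whole space when [e n] is empty or not open, so that every [W n] is
   open and dense. *)
pose W n := [set x | open (e n) -> e n !=set0 -> hit (e n) x].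
have odW n : open (W n) /\ dense (W n).
  have [[oe e0]|he] := pselect (open (e n) /\ e n !=set0).
    have -> : W n = hit (e n).
      by apply/seteqP; split => [x Wx|x hx _ _ //]; exact: Wx.
    by split; [exact: hit_open|exact: hit_dense].
  have -> : W n = setT by apply/seteqP; split => // x _ oe e0; case: he.
  by split; [exact: openT|move=> U U0 _; rewrite setIT].
have [p [_ Wp]] := Baire_compact _ _ hT cT odW _ T0 openT.
exists p => U oU [y Uy].
have [V [BV Vy] VU] := bB y U (open_nbhs_nbhs (conj oU Uy)).
have V0 : V !=set0 by exists y.
have [n en] := eP V BV V0.
have := Wp n I; rewrite /W /= en => /(_ (oB _ BV) V0) [k [k0 [z [Fz Vz]]]].
by exists k; split => //; exists z; split => //; exact: VU.
Qed.

Theorem proposition5p1 (R : realType) (X : metricType R)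
    (X_nonempty : [set: X] !=set0)
    (X_compact : compact [set: X])
    (X_no_isolated : isolated [set: X] = set0)
    (F : X -> set X)
    (F_hyperspace : forall x : X, hyperspace X (F x))
    (F_usc : upper_semicontinuous_sv F) :
  [/\ (exists p : X, has_dense_orbit F p) -> transitive_sv F,
      (exists p : X, has_dense_orbit F p) ->
        (exists p : X, has_weak_dense_orbit F p) &
      continuous_sv F -> transitive_sv F ->
        (exists p : X, has_weak_dense_orbit F p)].
Proof.
have hX : hausdorff_space X by exact: metric_hausdorff.
have T1 : accessible_space X by exact: hausdorff_accessible.
split=> [[p [x [xF xd]]] U V oU U0 oV V0|[p [x [xF xd]]]|[_ lscF] trF].
- have [i Ui] := xd U oU U0.
  have [k [k0 Vk]] := dense_orbit_tail _ _ _ i T1 X_no_isolated xd oV V0.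
  exists (x i); split => //; exists k; split => //.
  by exists (x (i + k)%N); split => //; exact: orbit_set_iter xF.
- exists p => U oU U0.
  (* Density alone might give only the visit [x 0 = p], which corresponds to the excluded exponent
     0; the tail after index 0 gives a positive one. *)
  have [k [k0 Uk]] := dense_orbit_tail _ _ _ 0 T1 X_no_isolated xd oU U0.
  exists k; split => //; exists (x k); split => //.
  by case: (xF) => <- _; exact: (orbit_set_iter _ _ _ _ 0 _ xF).
- apply: transitive_weak_dense_orbit => //.
  exact: compact_metric_second_countable.
Qed.
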